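(* Every pseudo-mitotic group $\Gamma$ is boundedly acyclic, i.e. $\operatorname{H}^n_b(\Gamma;\mathbb{R}) \cong 0$ for all $n \geq 1$.
   Context: For a group $\Gamma$, the bounded cohomology $\operatorname{H}^*_b(\Gamma;\mathbb{R})$ is the cohomology of the complex $\operatorname{C}^n_b(\Gamma;\mathbb{R}) = \ell^\infty(\Gamma^{n+1})^\Gamma$ of bounded real functions on $\Gamma^{n+1}$ invariant under the diagonal action, with the homogeneous coboundary. A subgroup $H \leq \Gamma$ has a pseudo-mitosis in $\Gamma$ if there are homomorphisms $\psi_0,\psi_1\colon H \to \Gamma$ and an element $g \in \Gamma$ such that (1) $h\psi_1(h) = \psi_0(h)$ for all $h \in H$; (2) $[h,\psi_1(h')] = 1$ for all $h,h' \in H$; (3) $\psi_1(h) = g^{-1}\psi_0(h) g$ for all $h \in H$. A group is pseudo-mitotic (also called binate) if every finitely generated subgroup of it has a pseudo-mitosis in it. *)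

(* Defs.v *)
From HB Require Import structures.
From mathcomp Require Import all_boot all_order all_algebra.
From Stdlib Require Import Reals.
From mathcomp Require Import Rstruct.

Set Implicit Arguments.
Unset Strict Implicit.
Unset Printing Implicit Defensive.

Import GRing.Theory.

Record Grp := {
  gcar :> Type;
  gmul : gcar -> gcar -> gcar;
  gone : gcar;
  ginv : gcar -> gcar;
  gmulA : forall x y z, gmul x (gmul y z) = gmul (gmul x y) z;
  gmul1g : forall x, gmul gone x = x;
  gmulVg : forall x, gmul (ginv x) x = gone
}.

Arguments gmul {g}.
Arguments gone {g}.
Arguments ginv {g}.

Section GroupNotions.
Variable G : Grp.

Definition gcomm (x y : G) : G := gmul (gmul (gmul (ginv x) (ginv y)) x) y.

Definition is_subgroup (H : G -> Prop) : Prop :=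
  H gone /\ (forall x y, H x -> H y -> H (gmul x y)) /\ (forall x, H x -> H (ginv x)).

Inductive generated (S : list G) : G -> Prop :=
  | gen_base : forall x, List.In x S -> generated S x
  | gen_one : generated S gone
  | gen_mul : forall x y, generated S x -> generated S y -> generated S (gmul x y)
  | gen_inv : forall x, generated S x -> generated S (ginv x).

Definition fg_subgroup (H : G -> Prop) : Prop :=
  is_subgroup H /\ exists S : list G, forall x, H x <-> generated S x.

Definition hom_on (H : G -> Prop) (psi : G -> G) : Prop :=
  forall h h', H h -> H h' -> psi (gmul h h') = gmul (psi h) (psi h').

Definition has_pseudo_mitosis (H : G -> Prop) : Prop :=
  exists (psi0 psi1 : G -> G) (g : G),
    hom_on H psi0 /\ hom_on H psi1 /\
    (forall h, H h -> gmul h (psi1 h) = psi0 h) /\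
    (forall h h', H h -> H h' -> gcomm h (psi1 h') = gone) /\
    (forall h, H h -> psi1 h = gmul (gmul (ginv g) (psi0 h)) g).

Definition pseudo_mitotic : Prop :=
  forall H : G -> Prop, fg_subgroup H -> has_pseudo_mitosis H.

(* Homogeneous bounded cochains: C^n_b(G;R) = l^oo(G^(n+1))^G *)
Definition cochain (n : nat) := ('I_n.+1 -> G) -> R.

Definition bounded_cochain n (f : cochain n) : Prop :=
  exists C : R, forall x, (Rabs (f x) <= C)%R.

Definition invariant_cochain n (f : cochain n) : Prop :=
  forall (g : G) x, f (fun j => gmul g (x j)) = f x.

Local Open Scope ring_scope.
Definition coboundary n (f : cochain n) : cochain n.+1 :=
  fun x => \sum_(i < n.+2) (-1) ^+ i * f (fun j => x (lift i j)).

Definition boundedly_acyclic : Prop :=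
  forall (m : nat) (f : cochain m.+1),
    bounded_cochain f -> invariant_cochain f ->
    (forall x, coboundary f x = 0%R) ->
    exists h : cochain m,
      bounded_cochain h /\ invariant_cochain h /\ forall x, coboundary h x = f x.

End GroupNotions.

(* Main.v *)
Require Import Defs.
From HB Require Import structures.
From mathcomp Require Import all_boot all_order all_algebra.
From Stdlib Require Import Reals.
From mathcomp Require Import Rstruct.
From mathcomp Require Import boolp classical_sets filter reals topology normedtype.
From mathcomp Require Import Rstruct_topology ring lra.

(* Write mu(a, b) = a psi1(b). For a cocycle f, the class of mu^* f restricts to
   psi0^* f on the diagonal, to f on the first factor and to psi1^* f on the
   second one. Conjugation identifies psi0^* f with psi1^* f, so f is a coboundary
   as soon as mu^* f is, up to a coboundary, the sum of its restrictions to the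
   two factors. The obstructions to this are the Kuenneth cross terms, which are
   killed by the vanishing in lower degrees after passing to smaller finitely
   generated subgroups. All the bounds are independent of the subgroup, so an
   ultralimit of the primitives over all finitely generated subgroups gives a
   bounded primitive on the whole group.

   Cochains of all degrees are encoded at once as functions on lists; the
   recursion [d f (x :: s) = f s - d (f (x :: _)) s] then replaces the
   alternating sum. *)

Set Implicit Arguments.
Unset Strict Implicit.
Unset Printing Implicit Defensive.

Import Order.TTheory GRing.Theory Num.Theory.
Import numFieldNormedType.Exports.
Local Open Scope ring_scope.

(** * The simplicial differential on lists *)

Section Cochains.
Variable R : realFieldType.

Fixpoint d X (f : seq X -> R) (s : seq X) : R :=
  if s is x :: s' then f s' - d (fun t => f (x :: t)) s' else 0.

(** Identities between cochains are available at one length only, and [d f s] sees just the faces of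
    [s], which have one entry less. *)
Lemma eq_d X (f f' : seq X -> R) s :
  (forall t, (size t).+1 = size s -> f t = f' t) -> d f s = d f' s.
Proof.
elim: s f f' => [//|x s IH] f f' e /=; rewrite e //.
by congr (_ - _); apply: IH => t st; apply: e; rewrite /= st.
Qed.

Lemma dB X (f f' : seq X -> R) s : d (fun t => f t - f' t) s = d f s - d f' s.
Proof. by elim: s f f' => [|x s IH] f f' /=; rewrite ?IH; ring. Qed.

Lemma dD X (f f' : seq X -> R) s : d (fun t => f t + f' t) s = d f s + d f' s.
Proof. by elim: s f f' => [|x s IH] f f' /=; rewrite ?IH; ring. Qed.

Lemma dZ X (c : R) (f : seq X -> R) s : d (fun t => c * f t) s = c * d f s.
Proof. by elim: s f => [|x s IH] f /=; rewrite ?IH; ring. Qed.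

Lemma d0 X s : d (fun _ : seq X => 0) s = 0.
Proof. by elim: s => [|x s IH] //=; rewrite IH; ring. Qed.

Lemma d_cst X (c : R) (s : seq X) : d (fun _ => c) s = if odd (size s) then c else 0.
Proof. by elim: s => [|x s IH] //=; rewrite IH; case: odd => /=; ring. Qed.

(** All faces of a constant list coincide, so they cancel in pairs. *)
Lemma d_nseq X (f : seq X -> R) x n :
  d f (nseq n.+1 x) = if odd n then 0 else f (nseq n x).
Proof.
elim: n f => [|n IH] f /=; first by ring.
have /= := IH (fun t => f (x :: t)); case: odd => /= ->; ring.
Qed.

Lemma d_map X Y (phi : X -> Y) (f : seq Y -> R) s :
  d (fun t => f (map phi t)) s = d f (map phi s).
Proof. by elim: s f => [|x s IH] f //=; rewrite -IH. Qed.

Lemma d_d X (f : seq X -> R) s : d (d f) s = 0.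
Proof. by elim: s f => [|x s IH] f //=; rewrite dB IH; ring. Qed.

Lemma d_comm X Y (v : seq X -> seq Y -> R) l s :
  d (fun l' => d (v l') s) l = d (fun t => d (v^~ t) l) s.
Proof.
elim: l v => [|a l IH] v /=; first by rewrite d0.
by rewrite (IH (fun l' => v (a :: l'))) -dB.
Qed.

Lemma le_d X (f : seq X -> R) M s :
  (forall t, (size t).+1 = size s -> `|f t| <= M) -> `|d f s| <= (size s)%:R * M.
Proof.
elim: s f => [|x s IH] f fM /=; first by rewrite normr0 mul0r.
have h1 := fM s erefl.
have h2 : `|d (fun t => f (x :: t)) s| <= (size s)%:R * M.
  by apply: IH => t st; apply: fM; rewrite /= st.
by rewrite -natr1 mulrDl mul1r; apply: le_trans (ler_normB _ _) _; lra.
Qed.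

(** * Prisms *)

(** The usual simplicial homotopy: the alternating sum over i of [f] on the list phi x_0, ..., phi
    x_i, psi x_i, ..., psi x_n. *)
Fixpoint prism X Y (phi psi : X -> Y) (f : seq Y -> R) (s : seq X) : R :=
  if s is x :: s' then
    f (phi x :: psi x :: map psi s') - prism phi psi (fun t => f (phi x :: t)) s'
  else 0.

Lemma eq_prism X Y (phi psi : X -> Y) f f' s :
  (forall t, size t = (size s).+1 -> f t = f' t) -> prism phi psi f s = prism phi psi f' s.
Proof.
elim: s f f' => [//|x s IH] f f' e /=; rewrite e /= ?size_map //.
by congr (_ - _); apply: IH => t st; apply: e; rewrite /= st.
Qed.

Lemma prismB X Y (phi psi : X -> Y) f f' s :
  prism phi psi (fun t => f t - f' t) s = prism phi psi f s - prism phi psi f' s.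
Proof. by elim: s f f' => [|x s IH] f f' /=; rewrite ?IH; ring. Qed.

Lemma prism0 X Y (phi psi : X -> Y) s : prism phi psi (fun _ => 0) s = 0.
Proof. by elim: s => [|x s IH] //=; rewrite IH; ring. Qed.

Lemma prism_homotopy X Y (phi psi : X -> Y) f s :
  d (prism phi psi f) s + prism phi psi (d f) s = f (map psi s) - f (map phi s).
Proof.
elim: s f => [|x s IH] f /=; first by ring.
have := IH (fun t => f (phi x :: t)).
rewrite dB prismB (d_map psi (fun t => f (phi x :: psi x :: t))) => e.
by lra.
Qed.

Lemma prism_cocycle X Y (phi psi : X -> Y) f s :
  (forall t, size t = (size s).+1 -> d f t = 0) ->
  d (prism phi psi f) s = f (map psi s) - f (map phi s).
Proof.
by move=> f0; rewrite -prism_homotopy (eq_prism _ _ f0) prism0 addr0.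
Qed.

Lemma prism_map X X' Y Y' (phi psi : X -> Y) (phi' psi' : X' -> Y')
    (g : X' -> X) (g' : Y' -> Y) f s :
  (forall x, phi (g x) = g' (phi' x)) -> (forall x, psi (g x) = g' (psi' x)) ->
  prism phi psi f (map g s) = prism phi' psi' (fun t => f (map g' t)) s.
Proof.
move=> ephi epsi; elim: s f => [//|x s IH] f /=.
by rewrite IH -map_comp (eq_map epsi) ephi epsi map_comp.
Qed.

Lemma le_prism X Y (phi psi : X -> Y) f M s :
  (forall t, size t = (size s).+1 -> `|f t| <= M) ->
  `|prism phi psi f s| <= (size s)%:R * M.
Proof.
elim: s f => [|x s IH] f fM /=; first by rewrite normr0 mul0r.
have h1 : `|f (phi x :: psi x :: map psi s)| <= M by apply: fM; rewrite /= size_map.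
have h2 : `|prism phi psi (fun t => f (phi x :: t)) s| <= (size s)%:R * M.
  by apply: IH => t st; apply: fM; rewrite /= st.
by rewrite -natr1 mulrDl mul1r; apply: le_trans (ler_normB _ _) _; lra.
Qed.

(** * The Alexander-Whitney map *)

Definition dl X Y (v : seq X -> seq Y -> R) l t := d (v^~ t) l.

Definition dr X Y (v : seq X -> seq Y -> R) l t := d (v l) t.

(** The front face is projected to [X], while the back face keeps its entries in [Y]; both faces
    contain the vertex of index [p]. *)
Fixpoint aw X Y (pi : Y -> X) (p : nat) (v : seq X -> seq Y -> R) (s : seq Y) {struct s} : R :=
  if s is y :: s' then
    if p is p'.+1 then aw pi p' (fun l => v (pi y :: l)) s' else v [:: pi y] s
  else 0.

Lemma awE X Y (pi : Y -> X) (p : nat) v (s : seq Y) : (p < size s)%nat ->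
  aw pi p v s = v (map pi (take p.+1 s)) (drop p s).
Proof.
elim: p v s => [|p IH] v [|y s] //= ps; first by rewrite take0.
by rewrite IH.
Qed.

(** Leibniz rule. The last face of the front part in [dl v] and the first face of the back part in
    [dr v] give the same term with opposite signs. *)
Lemma aw_dl_dr X Y (pi : Y -> X) (p : nat) v (s : seq Y) : (p.+1 < size s)%nat ->
  d (aw pi p v) s = aw pi p.+1 (dl v) s + (-1) ^+ p * aw pi p (dr v) s.
Proof.
elim: p v s => [|p IH] v [|y s] //=.
  case: s => [//|z s] _; rewrite /dl /dr /= expr0.
  by ring.
rewrite ltnS => ps.
rewrite (IH (fun l => v (pi y :: l))) // exprS.
have -> : aw pi p.+1 (fun l => dl v (pi y :: l)) s
    = aw pi p.+1 v s - aw pi p.+1 (dl (fun l => v (pi y :: l))) s.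
  by rewrite !awE.
by rewrite /dr; ring.
Qed.

End Cochains.

(** * Groups *)

Section Groups.
Variable G : Grp.
Implicit Types x y z : G.

Lemma gmulKg x y : gmul (ginv x) (gmul x y) = y.
Proof. by rewrite gmulA gmulVg gmul1g. Qed.

Lemma gmulI x y z : gmul x y = gmul x z -> y = z.
Proof. by move=> e; rewrite -(gmulKg x y) e gmulKg. Qed.

Lemma gmulg1 x : gmul x gone = x.
Proof. by apply: (@gmulI (ginv x)); rewrite gmulKg gmulVg. Qed.

Lemma gmulgV x : gmul x (ginv x) = gone.
Proof. by apply: (@gmulI (ginv x)); rewrite gmulKg gmulg1. Qed.

Lemma ginvM x y : ginv (gmul x y) = gmul (ginv y) (ginv x).
Proof.
apply: (@gmulI (gmul x y)).
by rewrite gmulgV -gmulA [gmul y _]gmulA gmulgV gmul1g gmulgV.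
Qed.

Lemma gcomm_eq1 x y : gcomm x y = gone -> gmul x y = gmul y x.
Proof.
rewrite /gcomm -!gmulA => e.
apply: (@gmulI (ginv y)); apply: (@gmulI (ginv x)).
by rewrite e gmulKg gmulVg.
Qed.

Lemma map_gmul1g (s : seq G) : map (gmul gone) s = s.
Proof. by elim: s => [|x s IH] //=; rewrite gmul1g IH. Qed.

End Groups.

Definition ghom (H K : Grp) (phi : H -> K) :=
  forall x y, phi (gmul x y) = gmul (phi x) (phi y).

Lemma ghom1 (H K : Grp) (phi : H -> K) : ghom phi -> phi gone = gone.
Proof.
by move=> hphi; apply: (@gmulI _ (phi gone)); rewrite -hphi gmul1g gmulg1.
Qed.

(** * Killing cocycles along a homomorphism *)

Section Killing.
Variable R : realFieldType.

Definition bdd X (k : nat) (M : R) (f : seq X -> R) :=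
  forall s, size s = k -> `|f s| <= M.

Definition ginvariant (G : Grp) (f : seq G -> R) :=
  forall g s, f (map (gmul g) s) = f s.

(* A homogeneous cochain of degree n lives on the lists of size n.+1. *)
Definition kills (n : nat) (C : R) (H K : Grp) (phi : H -> K) :=
  forall (f : seq K -> R) M, 0 <= M -> bdd n.+1 M f -> ginvariant f ->
    (forall s, size s = n.+2 -> d f s = 0) ->
  exists h : seq H -> R,
    [/\ bdd n (C * M) h, ginvariant h & forall s, size s = n.+1 -> d h s = f (map phi s)].

Definition act2 (A B : Grp) (a : A) (b : B) (x : A * B) :=
  (gmul a x.1, gmul b x.2).

(** The second variable ranges over the whole product, so [A] acts on both slots and [B] only on the
    second coordinates of the second slot. *)
Definition ginvariant2 (A B : Grp) (v : seq A -> seq (A * B) -> R) :=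
  forall a b l t, v (map (gmul a) l) (map (act2 a b) t) = v l t.

Definition bdd2 X Y (p q : nat) (M : R) (v : seq X -> seq Y -> R) :=
  forall l t, size l = p -> size t = q -> `|v l t| <= M.

Definition map2 (X Y Z : Type) (phi : Y -> Z) (x : X * Y) := (x.1, phi x.2).

(* For fixed l, the prism between the identity and (a, b) |-> (1, b) moves v l to a
   cocycle on B. Choosing primitives separately for each l only respects the action
   of B; the action of A is restored by first translating the head of l to 1. *)
Lemma kill_row n C (A B0 B : Grp) (phi : B0 -> B) p M v :
    ghom phi -> kills n C phi -> 0 <= M ->
    bdd2 p.+1 n.+1 M v -> @ginvariant2 A B v ->
    (forall l t, size l = p.+1 -> size t = n.+2 -> dr v l t = 0) ->
  exists u, [/\ bdd2 p.+1 n (C * M + n%:R * M) u, @ginvariant2 A B0 u &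
    forall l t, size l = p.+1 -> size t = n.+1 -> dr u l t = v l (map (map2 phi) t)].
Proof.
move=> hphi kphi M0 vM vI vZ.
pose f l (s : seq B) := v l (map (pair (gone : A)) s).
have fI l : ginvariant (f l).
  move=> b s; rewrite /f -[RHS](vI gone b l) map_gmul1g.
  rewrite -!map_comp; congr v; apply: eq_map => x /=.
  by rewrite /act2 /= gmul1g.
have /choice[w wP] : forall l, exists wl, size l = p.+1 ->
    [/\ bdd n (C * M) wl, ginvariant wl
      & forall s, size s = n.+1 -> d wl s = f l (map phi s)].
  move=> l.
  case: (eqVneq (size l) p.+1) => [sl|/eqP sl]; last by exists (fun=> 0).
  have [|||h hP] := kphi (f l) M M0; last by exists h.
  - by move=> s ss; apply: vM; rewrite ?size_map.
  - exact: fI.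
  - by move=> s ss; rewrite /f d_map; apply: vZ; rewrite ?size_map.
pose psi (x : A * B) := (gone : A, x.2).
pose P l := prism idfun psi (v l).
pose u0 l t := w l (map snd t) - P l (map (map2 phi) t).
(* The primitives [w l] are controlled at length [p.+1] only; the value 0 elsewhere makes [u]
   invariant at every length. *)
pose u l t := if l is a :: _ then if size l == p.+1 then
  u0 (map (gmul (ginv a)) l) (map (act2 (ginv a) gone) t) else 0 else 0.
have u0B l t (b : B0) : size l = p.+1 -> u0 l (map (act2 gone b) t) = u0 l t.
  move=> sl; have [_ wI _] := wP l sl; rewrite /u0; congr (_ - _).
    by rewrite -(wI b (map snd t)) -!map_comp.
  rewrite -map_comp (eq_map (g := act2 gone (phi b) \o map2 phi)); last first.
    by move=> x; rewrite /map2 /act2 /= hphi.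
  rewrite map_comp /P (prism_map (phi' := idfun) (psi' := psi) (g' := act2 gone (phi b))) //.
    by congr prism; apply: funext => s; rewrite -[RHS](vI gone (phi b) l) map_gmul1g.
  by move=> x; rewrite /psi /act2 /= gmul1g.
exists u; split.
- move=> [//|a l] t sl st; rewrite /u sl eqxx /u0.
  set l' := map _ _; set t' := map _ t.
  have sl' : size l' = p.+1 by rewrite size_map.
  have st' : size t' = n by rewrite size_map.
  have [wM _ _] := wP l' sl'.
  apply: le_trans (ler_normB _ _) _; apply: lerD; first by apply: wM; rewrite size_map.
  rewrite -st' -(size_map (map2 phi)); apply: le_prism => s.
  by rewrite size_map st' => ss; apply: vM.
- move=> a b [//|a0 l] t; rewrite /u [map _ (_ :: _)]/= [size _]/= size_map.
  case: ifP => // /eqP sl; rewrite -[RHS](u0B _ _ b) ?size_map // -!map_comp -map_cons.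
  rewrite -map_comp; congr u0; apply: eq_map => x /=.
    by rewrite ginvM -gmulA gmulKg.
  by rewrite /act2 /= ginvM -gmulA gmulKg !gmul1g.
- move=> [//|a l] t sl st; rewrite /dr /u sl eqxx d_map.
  set l' := map _ _; set t' := map _ t.
  have sl' : size l' = p.+1 by rewrite size_map.
  have st' : size t' = n.+1 by rewrite size_map.
  have [_ _ dw] := wP l' sl'.
  rewrite /u0 dB d_map d_map dw ?size_map // /P prism_cocycle; last first.
    by move=> s; rewrite size_map st' => ss; apply: vZ.
  have -> : f l' (map phi (map snd t')) = v l' (map psi (map (map2 phi) t')).
    by rewrite /f -!map_comp; congr v; apply: eq_map.
  (* The collapsed terms cancel, and the invariance of [v] undoes the translation by [ginv a]. *)
  rewrite map_id subKr -(vI (ginv a) gone (_ :: _)).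
  rewrite /t' -!map_comp; congr v; apply: eq_map => x.
  by rewrite /= /map2 /act2 /= !gmul1g.
Qed.
End Killing.

(** * Cross terms on a product *)

Section Splitting.
Variable R : realFieldType.

Lemma aw_map X X' Y Y' (pi : Y -> X) (pi' : Y' -> X') (g : Y' -> Y) (g' : X' -> X)
    p (v : seq X -> seq Y -> R) s :
  (forall y, pi (g y) = g' (pi' y)) ->
  aw pi p v (map g s) = aw pi' p (fun l t => v (map g' l) (map g t)) s.
Proof.
move=> e; elim: p v s => [|p IH] v [|y s] //=; first by rewrite e.
by rewrite e IH.
Qed.

Lemma aw_inv2 (A B : Grp) p (v : seq A -> seq (A * B) -> R) a b s :
  ginvariant2 v -> aw fst p v (map (act2 a b) s) = aw fst p v s.
Proof.
move=> vI; rewrite (aw_map (pi' := fst) (g' := gmul a)) //.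
by congr aw; apply: funext => l; apply: funext => t; apply: vI.
Qed.

Lemma inv_aw (H A B : Grp) (alpha : H -> A) (beta : H -> B) p v :
  ghom alpha -> ghom beta -> @ginvariant2 R A B v ->
  ginvariant (fun s => aw fst p v (map (fun x => (alpha x, beta x)) s)).
Proof.
move=> ha hb vI x s; rewrite -[RHS](aw_inv2 _ (alpha x) (beta x) _ vI) -!map_comp.
by congr aw; apply: eq_map => y; rewrite /act2 /= ha hb.
Qed.

Lemma le_aw X Y (pi : Y -> X) (p q : nat) M (v : seq X -> seq Y -> R) s :
  bdd2 p.+1 q.+1 M v -> size s = (p + q).+1 -> `|aw pi p v s| <= M.
Proof.
move=> vM ss; rewrite awE ?ss ?ltnS ?leq_addr //; apply: vM.
  by rewrite size_map size_takel // ss ltnS leq_addr.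
by rewrite size_drop ss -addnS addKn.
Qed.

Lemma eq_aw X Y (pi : Y -> X) (p q : nat) (v v' : seq X -> seq Y -> R) s :
  (forall l t, size l = p.+1 -> size t = q.+1 -> v l t = v' l t) ->
  size s = (p + q).+1 -> aw pi p v s = aw pi p v' s.
Proof.
move=> e ss; rewrite !awE ?ss ?ltnS ?leq_addr //; apply: e.
  by rewrite size_map size_takel // ss ltnS leq_addr.
by rewrite size_drop ss -addnS addKn.
Qed.

Lemma ghom_cst1 (H K : Grp) : ghom (fun _ : H => gone : K).
Proof. by move=> x y; rewrite gmul1g. Qed.

Definition bicocycle (A B : Grp) (p q : nat) (M : R) (v : seq A -> seq (A * B) -> R) :=
  [/\ bdd2 p.+1 q.+1 M v, ginvariant2 v,
      (forall l t, size l = p.+2 -> size t = q.+1 -> dl v l t = 0) &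
      (forall l t, size l = p.+1 -> size t = q.+2 -> dr v l t = 0)].

(* The vanishing of the cross term of bidegree (p, q). *)
Definition splits (p q : nat) (C : R) (H B : Grp) (phi : H -> B) :=
  forall (A : Grp) (alpha : H -> A) v M, ghom alpha -> 0 <= M ->
    @bicocycle A B p q M v ->
  exists h : seq H -> R, [/\ bdd (p + q) (C * M) h, ginvariant h &
    forall s, size s = (p + q).+1 ->
      d h s = aw fst p v (map (fun x => (alpha x, phi x)) s)
            - aw fst p v (map (fun x => (alpha x, gone)) s)].

(** In bidegree (p, 0) the vanishing of [dr v] makes [v l] agree at any two vertices, so the two
    terms are already equal. *)
Lemma splits0 p (H B : Grp) (phi : H -> B) : splits p 0 0 phi.
Proof.
move=> A alpha v M ha M0 [_ _ _ vZ]; exists (fun=> 0); split=> //.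
  by move=> s _; rewrite normr0 mul0r.
rewrite addn0 => s ss; rewrite d0 !awE ?size_map ?ss //.
rewrite -!map_take -!map_drop -!map_comp.
have : size (drop p s) = 1%nat by rewrite size_drop ss subSnn.
case: (drop p s) => [|x []] //= _.
have := vZ (map alpha (take p.+1 s)) [:: (alpha x, gone); (alpha x, phi x)].
rewrite size_map size_takel ?ss // => /(_ erefl erefl).
by rewrite /dr /= subr0 => ->.
Qed.

(* If dr u = v, then aw p v and aw p.+1 (dl u) agree up to sign and coboundary. *)
Lemma splitsS (p q : nat) C C' (H B1 B : Grp) (phi0 : H -> B1) (phi1 : B1 -> B) :
  ghom phi0 -> ghom phi1 -> 0 <= C' ->
  splits p.+1 q C phi0 -> kills q.+1 C' phi1 ->
  splits p q.+1 ((2 + C * p.+2%:R) * (C' + q.+1%:R)) (phi1 \o phi0).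
Proof.
move=> h0 h1 C'0 sphi kphi A alpha v M ha M0 [vM vI vl vr].
have [u [uM uI ur]] := kill_row h1 kphi M0 vM vI vr.
set M1 := (C' * M + q.+1%:R * M) in uM.
have M10 : 0 <= M1 by rewrite addr_ge0 // mulr_ge0.
(* [dl u] is a bicocycle of bidegree (p+1, q): its [dr] equals [dl] of [dr u], that is [dl] of a
   pullback of [v], which vanishes. *)
have [||h [hM hI hd]] := sphi A alpha (dl u) (p.+2%:R * M1) ha.
- by rewrite mulr_ge0.
- split.
  + by move=> l t sl st; rewrite -sl; apply: le_d => l'; rewrite sl => -[sl']; apply: uM.
  + move=> a b l t; rewrite /dl -d_map.
    by congr d; apply: funext => l'; apply: uI.
  + by move=> l t _ _; rewrite /dl d_d.
  + move=> l t sl st; rewrite /dr /dl -d_comm.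
    rewrite (eq_d (f' := fun l' => v l' (map (map2 phi1) t))).
      by apply: vl; rewrite ?size_map.
    by rewrite sl => l' [sl']; apply: ur.
pose u' (beta : H -> B1) s := aw fst p u (map (fun x => (alpha x, beta x)) s).
have u'M beta : bdd (p + q.+1) M1 (u' beta).
  by move=> s ss; apply: (@le_aw _ _ _ _ q); rewrite ?size_map // -addnS.
have du' beta s : size s = (p + q.+1).+1 ->
    aw fst p v (map (fun x => (alpha x, phi1 (beta x))) s) =
    (-1) ^+ p * (d (u' beta) s - aw fst p.+1 (dl u) (map (fun x => (alpha x, beta x)) s)).
  move=> ss; rewrite /u' d_map aw_dl_dr ?size_map ?ss ?ltnS ?addnS ?ltnS ?leq_addr //.
  rewrite addrAC subrr add0r mulrA -expr2 sqrr_sign mul1r.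
  rewrite (@eq_aw _ _ _ _ q.+1 _ ( fun l t => v l (map (map2 phi1) t))) ?size_map //.
  rewrite [map (fun x => (alpha x, phi1 (beta x))) s](_ : _ =
     map (map2 phi1) (map (fun x => (alpha x, beta x)) s)); last by rewrite -map_comp.
  rewrite (aw_map (pi' := fst) (g' := idfun)) //.
  by congr aw; apply: funext => l; rewrite map_id.
(* The difference of two instances of [du'], where [h] accounts for the terms in [dl u]. Each [u']
   is bounded by [M1], and [h] by C(p+2) times [M1], whence the constant. *)
exists (fun s => (-1) ^+ p * ((u' phi0 s - u' (fun=> gone) s) - h s)); split.
- move=> s ss; rewrite normrM normrX normrN1 expr1n mul1r.
  have e1 := u'M phi0 s ss; have e2 := u'M (fun=> gone) s ss.
  have e3 : `|h s| <= C * (p.+2%:R * M1) by apply: hM; rewrite ss addnS.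
  apply: le_trans (ler_normB _ _) _.
  apply: le_trans (lerD (ler_normB _ _) e3) _.
  have -> : (2 + C * p.+2%:R) * (C' + q.+1%:R) * M = M1 + M1 + C * (p.+2%:R * M1).
    by rewrite /M1; ring.
  by lra.
- move=> x s; rewrite hI /u' (inv_aw p ha h0 uI).
  by rewrite (inv_aw p ha (@ghom_cst1 _ _) uI).
- move=> s ss; rewrite dZ 2!dB hd ?ss ?addnS //.
  (* Reading [gone] as [phi1 gone] brings the second term into the form treated by [du']. *)
  rewrite (du' phi0) // -[in X in _ = _ - X](ghom1 h1) (du' (fun=> gone)) //.
  by ring.
Qed.
End Splitting.

(** * Killing cocycles by a pseudo-mitosis *)

Section MainStep.
Variable R : realFieldType.

(** Collapsing the first coordinate to a point [a] by a prism relates the pullback of [f] under [mu]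
    to that under [psi1]. The dependence of the prism on [a] is a single bicocycle of bidegree (1,
    n), so one use of [splits] suffices. *)
Lemma kills_pseudo_mitosis (n : nat) (C : R) (H B K : Grp) (phi : H -> B)
    (iota psi0 psi1 : B -> K) (g : K) :
  ghom phi -> ghom iota -> ghom psi0 -> ghom psi1 ->
  (forall x, gmul (iota x) (psi1 x) = psi0 x) ->
  (forall x y, gmul (iota x) (psi1 y) = gmul (psi1 y) (iota x)) ->
  (forall x, psi1 x = gmul (gmul (ginv g) (psi0 x)) g) ->
  splits 1 n C phi ->
  kills n.+1 ((3 + C * 2) * n.+1%:R + 1) (iota \o phi).
Proof.
move=> hphi hiota hpsi0 hpsi1 e0 e1 e2 sphi f M M0 fM fI fd.
pose mu (x : B * B) := gmul (iota x.1) (psi1 x.2).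
have muM a b x : mu (act2 a b x) = gmul (mu (a, b)) (mu x).
  by rewrite /mu /= hiota hpsi1 -!gmulA [gmul (iota x.1) _]gmulA e1 -!gmulA e1.
pose F (t : seq (B * B)) := f (map mu t).
have FI a b t : F (map (act2 a b) t) = F t.
  rewrite /F -[RHS](fI (mu (a, b))) -!map_comp; congr f; apply: eq_map => x /=.
  exact: muM.
pose psi (a : B) (x : B * B) := (a, x.2).
pose u l t := if l is a :: _ then prism idfun (psi a) F t else 0.
have uM : bdd2 1 n.+1 (n.+1%:R * M) u.
  move=> [//|a l] t _ st; rewrite -st; apply: le_prism => s ss.
  by apply: fM; rewrite size_map ss st.
have uI : ginvariant2 u.
  move=> a b [//|x l] t /=.
  rewrite (prism_map (phi' := idfun) (psi' := psi x) (g' := act2 a b)) //.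
  by congr prism; apply: funext => s; apply: FI.
have du a l t : size t = n.+2 -> dr u (a :: l) t = f (map psi1 (map snd t)) - F t.
  move=> st; rewrite /dr /u prism_cocycle ?map_id.
    by congr (_ - _); rewrite -[RHS](fI (iota a)) /F -!map_comp; congr f.
  by move=> s; rewrite st => ss; rewrite /F d_map; apply: fd; rewrite size_map.
have [||h1 [h1M h1I h1d]] := sphi B phi (dl u) (2 * (n.+1%:R * M)) hphi.
- by rewrite !mulr_ge0.
- split.
  + by move=> l t sl st; rewrite -sl; apply: le_d => l'; rewrite sl => -[sl']; apply: uM.
  + move=> a b l t; rewrite /dl -d_map.
    by congr d; apply: funext => l'; apply: uI.
  + by move=> l t _ _; rewrite /dl d_d.
  (* By [du], [dr u] does not depend on the base point, so its values at [a] and [b] cancel. *)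
  + move=> [|a [|b []]] // t _ st; rewrite /dr /dl -d_comm /=.
    by rewrite -/(dr u _ _) -/(dr u _ _) !du // subr0 subrr.
pose k (beta : H -> B) s := aw fst 0 u (map (fun x => (phi x, beta x)) s).
have kM beta : bdd n.+1 (n.+1%:R * M) (k beta).
  by move=> s ss; apply: (@le_aw _ _ _ _ 0 n); rewrite ?size_map // add0n.
have dk beta s : size s = n.+2 -> d (k beta) s =
    aw fst 1 (dl u) (map (fun x => (phi x, beta x)) s) +
    (f (map psi1 (map beta s)) - F (map (fun x => (phi x, beta x)) s)).
  case: s => [//|x s] ss; rewrite /k d_map aw_dl_dr ?size_map ?ss // expr0 mul1r.
  by rewrite /= du -?map_cons ?size_map // -[map snd _]map_comp.
pose tau x := psi0 (phi x).
(* Right translation by [g] commutes with the left action, so this prism is invariant; it makes the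
   pullbacks under [psi0] and [psi1] cohomologous. *)
pose conj s := prism tau (fun x => gmul (tau x) g) f s.
have htau : ghom tau by move=> x y; rewrite /tau hphi hpsi0.
pose c := f (nseq n.+2 gone).
(* In units of (n+1)M, the two [k] and [conj] contribute 1 each and [h1] contributes 2C; the last
   summand [c] adds M. *)
exists (fun s => (k phi s - k (fun=> gone) s) - h1 s - conj s + c); split.
- move=> s ss; have b1 := kM phi s ss; have b2 := kM (fun=> gone) s ss.
  have b3 := h1M s ss.
  have b4 : `|conj s| <= n.+1%:R * M.
    by rewrite -ss; apply: le_prism => t; rewrite ss; apply: fM.
  have b5 : `|c| <= M by apply: fM; rewrite size_nseq.
  apply: le_trans (ler_normD _ _) _; apply: le_trans (lerD (ler_normB _ _) b5) _.
  apply: le_trans (lerD (lerD (ler_normB _ _) b4) (lexx _)) _.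
  apply: le_trans (lerD (lerD (lerD (ler_normB _ _) b3) (lexx _)) (lexx _)) _.
  have -> : ((3 + C * 2) * n.+1%:R + 1) * M =
    n.+1%:R * M + n.+1%:R * M + C * (2 * (n.+1%:R * M)) + n.+1%:R * M + M by ring.
  by rewrite !lerD.
- move=> x s; rewrite /k (inv_aw 0 hphi hphi uI) (inv_aw 0 hphi (@ghom_cst1 _ _) uI) h1I.
  congr (_ - _ + _); rewrite /conj.
  rewrite (prism_map (phi' := tau) (psi' := fun y => gmul (tau y) g) (g' := gmul (tau x))).
  + by congr prism; apply: funext => t; apply: fI.
  + by move=> y; rewrite htau.
  + by move=> y; rewrite htau gmulA.
- move=> s ss.
  rewrite dD 3!dB d_cst h1d // !dk // /conj prism_cocycle ss; last first.
    by move=> t st; apply: fd.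
  have -> : F (map (fun x => (phi x, phi x)) s) = f (map tau s).
    by rewrite /F -map_comp; congr f; apply: eq_map => x; apply: e0.
  have -> : F (map (fun x => (phi x, gone)) s) = f (map (iota \o phi) s).
    rewrite /F -map_comp; congr f; apply: eq_map => x.
    by rewrite /mu /= (ghom1 hpsi1) gmulg1.
  have -> : f (map psi1 (map phi s)) = f (map (fun x => gmul (tau x) g) s).
    rewrite -[LHS](fI g) -!map_comp; congr f; apply: eq_map => x /=.
    by rewrite e2 !gmulA gmulgV gmul1g.
  have -> : f (map psi1 (map (fun=> gone) s)) = c.
    rewrite -map_comp /c -ss; congr f; elim: (s) => //= x s' ->.
    by rewrite (ghom1 hpsi1).
  (* For [n.+2] even, the cocycle condition on a constant list of length [n.+3] forces [c] to be
     0. *)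
  have -> : (if odd n.+2 then c else 0) = c.
    have := fd (nseq n.+3 gone); rewrite size_nseq d_nseq -/c => /(_ erefl).
    by case: odd.
  by ring.
Qed.

End MainStep.

(** * Finitely generated subgroups *)

Section Subgroups.
Variable G : Grp.

Lemma sval_inj (H : G -> Prop) (x y : {x | H x}) : sval x = sval y -> x = y.
Proof.
case: x y => [x hx] [y hy] /= e; case: y / e hy => hy.
by rewrite (Prop_irrelevance hx hy).
Qed.

Section SubgroupGrp.
Variables (H : G -> Prop) (hH : is_subgroup H).

Definition sub_one : {x | H x} := exist _ gone (proj1 hH).

Definition sub_mul (x y : {x | H x}) : {x | H x} :=
  exist _ (gmul (sval x) (sval y)) (proj1 (proj2 hH) _ _ (svalP x) (svalP y)).

Definition sub_inv (x : {x | H x}) : {x | H x} :=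
  exist _ (ginv (sval x)) (proj2 (proj2 hH) _ (svalP x)).

Definition subgroup_Grp : Grp.
Proof.
apply: (@Build_Grp {x | H x} sub_mul sub_one sub_inv).
- by move=> x y z; apply: sval_inj; apply: gmulA.
- by move=> x; apply: sval_inj; apply: gmul1g.
- by move=> x; apply: sval_inj; apply: gmulVg.
Defined.

End SubgroupGrp.

Definition incl (H K : G -> Prop) (hH : is_subgroup H) (hK : is_subgroup K)
    (HK : forall x, H x -> K x) (x : subgroup_Grp hH) : subgroup_Grp hK :=
  exist _ (sval x) (HK _ (svalP x)).

Lemma ghom_incl H K hH hK HK : ghom (@incl H K hH hK HK).
Proof. by move=> x y; apply: sval_inj. Qed.

Lemma incl_comp H K L hH hK hL (HK : forall x, H x -> K x) (KL : forall x, K x -> L x) :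
  @incl K L hK hL KL \o @incl H K hH hK HK = incl hL (fun x h => KL x (HK x h)).
Proof. by apply: funext => x; apply: sval_inj. Qed.

Lemma generated_subgroup (S : list G) : is_subgroup (generated S).
Proof. by split; [exact: gen_one | split; [exact: gen_mul | exact: gen_inv]]. Qed.

Lemma fg_generated (S : list G) : fg_subgroup (generated S).
Proof. by split; [exact: generated_subgroup | exists S]. Qed.

Lemma generated_le (S : list G) (K : G -> Prop) :
  is_subgroup K -> (forall x, List.In x S -> K x) -> forall x, generated S x -> K x.
Proof.
move=> [K1 [KM KV]] SK x; elim=> [|//|y z _ Ky _ Kz|y _ Ky]; first exact: SK.
  exact: KM.
exact: KV.
Qed.

(** Multiplicativity on the generated subgroup already forces [psi] to respect the unit and inverses
    there. *)
Lemma hom_on_generated (S : list G) (K : G -> Prop) (psi : G -> G) :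
  is_subgroup K -> hom_on (generated S) psi ->
  (forall x, List.In x S -> K (psi x)) -> forall x, generated S x -> K (psi x).
Proof.
move=> [K1 [KM KV]] hpsi SK.
have psi1 : psi gone = gone.
  apply: (@gmulI _ (psi gone)).
  by rewrite -hpsi ?gmul1g ?gmulg1 //; exact: gen_one.
move=> x; elim=> [y /SK //||y z hy Ky hz Kz|y hy Ky]; first by rewrite psi1.
  by rewrite hpsi //; apply: KM.
suff -> : psi (ginv y) = ginv (psi y) by apply: KV.
apply: (@gmulI _ (psi y)); rewrite -hpsi //; last exact: gen_inv.
by rewrite !gmulgV.
Qed.

End Subgroups.

(** * Induction on the degree over finitely generated subgroups *)

Section Tower.
Variables (R : realFieldType) (G : Grp).

(** [C] is chosen before [H]: this uniformity keeps the primitives bounded in the ultralimit. *)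
Definition eventually_kills (n : nat) := exists2 C : R, 0 <= C &
  forall (H : G -> Prop) (hH : is_subgroup H), fg_subgroup H ->
  exists (K : G -> Prop) (hK : is_subgroup K) (HK : forall x, H x -> K x),
    fg_subgroup K /\ kills n C (@incl G H K hH hK HK).

Definition eventually_splits (p q : nat) := exists2 C : R, 0 <= C &
  forall (H : G -> Prop) (hH : is_subgroup H), fg_subgroup H ->
  exists (K : G -> Prop) (hK : is_subgroup K) (HK : forall x, H x -> K x),
    fg_subgroup K /\ splits p q C (@incl G H K hH hK HK).

(** Each enlargement that kills degree q trades bidegree (p, q) for (p+1, q-1), until q is 0. Only
    degrees 1 to q are used. *)
Lemma eventually_splits_of_kills (q : nat) :
  (forall n, (n < q)%nat -> eventually_kills n.+1) -> forall p, eventually_splits p q.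
Proof.
elim: q => [|q IH] kq p.
  exists 0 => // H hH fgH; exists H, hH, (fun x h => h); split=> //.
  exact: splits0.
have [C C0 spl] := IH (fun n nq => kq n (ltnW nq)) p.+1.
have [C' C'0 kil] := kq q (ltnSn q).
exists ((2 + C * p.+2%:R) * (C' + q.+1%:R)).
  by rewrite mulr_ge0 // addr_ge0 // mulr_ge0.
move=> H hH fgH; have [K [hK [HK [fgK splK]]]] := spl H hH fgH.
have [L [hL [KL [fgL kilL]]]] := kil K hK fgK.
exists L, hL, (fun x h => KL x (HK x h)); split=> //.
rewrite -(incl_comp hH hK).
exact: (splitsS (ghom_incl _ HK) (ghom_incl _ KL) C'0 splK kilL).
Qed.

Hypothesis pmG : pseudo_mitotic G.

Lemma fg_pseudo_mitosis (B : G -> Prop) (hB : is_subgroup B) : fg_subgroup B ->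
  exists (K : G -> Prop) (hK : is_subgroup K) (BK : forall x, B x -> K x)
      (psi0 psi1 : subgroup_Grp hB -> subgroup_Grp hK) (g : subgroup_Grp hK),
  [/\ fg_subgroup K, ghom psi0, ghom psi1 &
  let iota := @incl G B K hB hK BK in
  [/\ forall x, gmul (iota x) (psi1 x) = psi0 x,
      forall x y, gmul (iota x) (psi1 y) = gmul (psi1 y) (iota x) &
      forall x, psi1 x = gmul (gmul (ginv g) (psi0 x)) g]].
Proof.
move=> fgB; have [_ [S BS]] := fgB.
have [psi0 [psi1 [g [h0 [h1 [e0 [e1 e2]]]]]]] := pmG fgB.
(* With [g] and the images of the generators added, the whole pseudo-mitosis takes place in a
   finitely generated subgroup. *)
pose L := (g :: S ++ map psi0 S ++ map psi1 S)%list.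
have hK := generated_subgroup L.
have inL x : List.In x S \/ List.In x (map psi0 S) \/ List.In x (map psi1 S) ->
    generated L x.
  by move=> h; apply: gen_base; right; apply/List.in_app_iff; rewrite List.in_app_iff.
have BK x : B x -> generated L x.
  by move=> /BS; apply: (generated_le hK) => y yS; apply: inL; left.
have onB psi : hom_on B psi -> hom_on (generated S) psi.
  by move=> hpsi x y /BS Bx /BS By; apply: hpsi.
have K0 x : B x -> generated L (psi0 x).
  move=> /BS; apply: (hom_on_generated hK); first exact: onB.
  by move=> y yS; apply: inL; right; left; apply: List.in_map.
have K1 x : B x -> generated L (psi1 x).
  move=> /BS; apply: (hom_on_generated hK); first exact: onB.
  by move=> y yS; apply: inL; right; right; apply: List.in_map.
have Kg : generated L g by apply: gen_base; left.
exists (generated L), hK, BK.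
exists (fun x => exist _ (psi0 (sval x)) (K0 _ (svalP x))).
exists (fun x => exist _ (psi1 (sval x)) (K1 _ (svalP x))).
exists (exist _ g Kg); split.
- exact: fg_generated.
- by move=> x y; apply: sval_inj; exact: h0 (svalP x) (svalP y).
- by move=> x y; apply: sval_inj; exact: h1 (svalP x) (svalP y).
split.
- by move=> x; apply: sval_inj; exact: e0 (svalP x).
- by move=> x y; apply: sval_inj; exact: gcomm_eq1 (e1 _ _ (svalP x) (svalP y)).
- by move=> x; apply: sval_inj; exact: e2 (svalP x).
Qed.

(** Degree n+1 needs the splitting in bidegree (1, n), hence killing in degrees 1 to n; strong
    induction starts with nothing to assume. *)
Lemma pseudo_mitotic_kills (n : nat) : eventually_kills n.+1.
Proof.
elim/ltn_ind: n => n IH.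
have [C C0 spl] := eventually_splits_of_kills IH 1.
exists ((3 + C * 2) * n.+1%:R + 1); first by rewrite addr_ge0 // mulr_ge0 // addr_ge0 // mulr_ge0.
move=> H hH fgH; have [B [hB [HB [fgB splB]]]] := spl H hH fgH.
have [K [hK [BK [psi0 [psi1 [g [fgK h0 h1 [e0 e1 e2]]]]]]]] := fg_pseudo_mitosis hB fgB.
exists K, hK, (fun x h => BK x (HB x h)); split=> //.
rewrite -(incl_comp hH hB).
exact: (kills_pseudo_mitosis (ghom_incl _ HB) (ghom_incl _ BK) h0 h1 e0 e1 e2 splB).
Qed.

End Tower.

(** * Ultralimits of primitives *)

Section UltraLimit.
Local Open Scope classical_set_scope.
Variable R : realType.

(** Compactness of the segment gives a cluster point, and an ultrafilter converges to each of its
    cluster points. *)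
Lemma ultra_bounded_cvg (T : Type) (U : set_system T) (r : T -> R) (M : R) :
  UltraFilter U -> (forall t, `|r t| <= M) -> exists2 l, `|l| <= M & r @ U --> l.
Proof.
move=> UU rM.
have rU : (r @ U) `[- M, M].
  by apply: (@filterE _ U _) => t; rewrite /= in_itv /= -ler_norml.
have [l [lM lU]] := @segment_compact R (- M) M (r @ U) _ rU.
exists l; first by move: lM; rewrite /= in_itv /= -ler_norml.
move=> A lA; have [//|UA] := in_ultra_setVsetC (r @^-1` A) UU.
by have [y [nAy Ay]] := lU (~` A) A UA lA.
Qed.

Lemma cvg_d (T X : Type) (U : set_system T) (f : T -> seq X -> R) (h : seq X -> R) s :
  Filter U -> (forall t, (size t).+1 = size s -> f^~ t @ U --> h t) ->
  (fun i => d (f i) s) @ U --> d h s.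
Proof.
move=> FU; elim: s f h => [|x s IH] f h fh /=; first exact: cvg_cst.
apply: cvgB; first exact: fh.
by apply: (IH (fun i t => f i (x :: t))) => t st; apply: fh; rewrite /= st.
Qed.

Lemma cvg_eventually_eq (T : Type) (U : set_system T) (r r' : T -> R) (l l' : R) :
  ProperFilter U -> U [set t | r t = r' t] -> r @ U --> l -> r' @ U --> l' -> l = l'.
Proof.
move=> FU e rl rl'; apply: (@norm_cvg_unique _ _ (r @ U)) => //.
apply: cvg_trans rl'; apply: near_eq_cvg.
by apply: (filterS _ e) => t /= ->.
Qed.

(** Finitely generated subgroups are indexed by generating lists, which concatenation makes
    directed; this is the filter of tails. *)
Definition containing (T : Type) : set_system (list T) :=
  [set A | exists S0 : list T, forall S, List.incl S0 S -> A S].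

Lemma containing_proper (T : Type) : ProperFilter (@containing T).
Proof.
split.
  by case=> S0 /(_ S0); apply; apply: List.incl_refl.
split.
- by exists nil.
- move=> A B [SA hA] [SB hB]; exists (SA ++ SB)%list => S hS; split.
    by apply: hA => x hx; apply: hS; apply/List.in_app_iff; left.
  by apply: hB => x hx; apply: hS; apply/List.in_app_iff; right.
- by move=> A B AB [S0 hS]; exists S0 => S /hS /AB.
Qed.

End UltraLimit.

(** * From local primitives to a primitive on the whole group *)

Section ListCochains.
Local Open Scope classical_set_scope.
Variables (R : realType) (G : Grp).

(** The primitive on [H] is extended by 0 to lists that leave [H]: the bound survives everywhere,
    the two identities inside [H]. *)
Lemma local_primitive n C M (f : seq G -> R) (H K : G -> Prop)
    (hH : is_subgroup H) (hK : is_subgroup K) (HK : forall x, H x -> K x) :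
  0 <= C -> kills n C (@incl G H K hH hK HK) -> 0 <= M -> bdd n.+1 M f -> ginvariant f ->
  (forall s, size s = n.+2 -> d f s = 0) ->
  exists h : seq G -> R, [/\ bdd n (C * M) h,
    forall g s, H g -> List.Forall H s -> h (map (gmul g) s) = h s &
    forall s, List.Forall H s -> size s = n.+1 -> d h s = f s].
Proof.
move=> C0 kHK M0 fM fI fd.
have [|||h [hM hI hd]] := kHK (fun s => f (map sval s)) M M0.
- by move=> s ss; apply: fM; rewrite size_map.
- by move=> g s; rewrite -(fI (sval g) (map sval s)) -!map_comp.
- by move=> s ss; rewrite d_map; apply: fd; rewrite size_map.
have lift s : List.Forall H s -> exists t : seq (subgroup_Grp hH), map sval t = s.
  elim=> [|x s' Hx _ [t <-]]; first by exists [::].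
  by exists (exist _ x Hx :: t).
have sval_map_inj (t t' : seq (subgroup_Grp hH)) : map sval t = map sval t' -> t = t'.
  by apply: inj_map => x y; apply: sval_inj.
pose h' s := if pselect (exists t : seq (subgroup_Grp hH), map sval t = s) is left e
  then h (sval (cid e)) else 0.
have h'E t : h' (map sval t) = h t.
  rewrite /h'; case: pselect => [e|[]]; last by exists t.
  by congr h; apply: sval_map_inj; case: (cid e).
exists h'; split.
- move=> s ss; rewrite /h'; case: pselect => [e|_]; last first.
    by rewrite normr0 mulr_ge0.
  by apply: hM; case: (cid e) => t /= ts; rewrite -ss -ts size_map.
- by move=> g s Hg /lift[t <-]; rewrite h'E -(hI (exist _ g Hg)) -h'E -!map_comp.
- move=> s /lift[t <-]; rewrite size_map => st.
  rewrite -d_map (eq_d (f' := h)) => [|t' _]; last exact: h'E.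
  by rewrite hd // -map_comp.
Qed.

Lemma pseudo_mitotic_primitive n M (f : seq G -> R) :
  pseudo_mitotic G -> 0 <= M -> bdd n.+2 M f -> ginvariant f ->
  (forall s, size s = n.+3 -> d f s = 0) ->
  exists (M' : R) (h : seq G -> R), [/\ bdd n.+1 M' h,
    forall g s, size s = n.+1 -> h (map (gmul g) s) = h s &
    forall s, size s = n.+2 -> d h s = f s].
Proof.
move=> pmG M0 fM fI fd.
have [C C0 killG] := @pseudo_mitotic_kills R G pmG n.
have /choice[h hP] : forall S : list G, exists h : seq G -> R, [/\ bdd n.+1 (C * M) h,
    forall g s, generated S g -> List.Forall (generated S) s -> h (map (gmul g) s) = h s &
    forall s, List.Forall (generated S) s -> size s = n.+2 -> d h s = f s].
  move=> S; have [K [hK [SK [_ kilS]]]] := killG _ (generated_subgroup S) (fg_generated S).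
  exact: local_primitive C0 kilS M0 fM fI fd.
have [U [UU sU]] := ultraFilterLemma (containing_proper G).
have inU s : U [set S | List.Forall (generated S) s].
  apply: sU; exists s => S sS; apply/List.Forall_forall => x xs.
  exact/gen_base/sS.
(* The uniform bound holds at length [n.+1] only; at other lengths the limit may fail to exist and 0
   is taken. *)
have /choice[k kP] : forall s, exists l, size s = n.+1 ->
    `|l| <= C * M /\ (h^~ s) @ U --> l.
  move=> s; case: (eqVneq (size s) n.+1) => [ss|/eqP ss]; last by exists 0.
  have [|l lM hl] := @ultra_bounded_cvg R _ U (h^~ s) (C * M) UU.
    by move=> S; have [hM _ _] := hP S; apply: hM.
  by exists l.
exists (C * M), k; split.
- by move=> s /kP[].
- move=> g s ss; have [_ h1] := kP _ ss.
  have [|_ h2] := kP (map (gmul g) s); first by rewrite size_map.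
  apply: cvg_eventually_eq h2 h1.
  (* Putting [g] in the list ensures that the subgroup eventually contains the translating element
     as well. *)
  apply: filterS (inU (g :: s)) => S /= Sgs.
  have [_ hI _] := hP S; inversion Sgs; exact: hI.
- move=> s ss.
  have h1 : (fun S => d (h S) s) @ U --> d k s.
    by apply: cvg_d => t; rewrite ss => -[st]; have [] := kP t st.
  apply: cvg_eventually_eq h1 (cvg_cst (f s)).
  by apply: filterS (inU s) => S /= Ss; have [_ _ hd] := hP S; apply: hd.
Qed.

End ListCochains.

(** * Translation between lists and functions on ordinals *)

Lemma d_coboundary (X : Type) n (f : seq X -> R) (x : 'I_n.+1 -> X) :
  d f (map x (enum 'I_n.+1)) =
  \sum_(i < n.+1) (-1) ^+ i * f (map (fun j => x (lift i j)) (enum 'I_n)).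
Proof.
elim: n f x => [|n IH] f x.
  rewrite big_ord_recl big_ord0 enum_ordSl.
  have -> : enum 'I_0 = [::] by apply: size0nil; rewrite size_enum_ord.
  by rewrite /= expr0 mul1r subr0 addr0.
rewrite big_ord_recl expr0 mul1r enum_ordSl [map x _]/= -map_comp /=.
congr (_ + _).
(* A face of positive index keeps the head [x ord0], and its shifted sign absorbs the minus of the
   recursion. *)
rewrite (IH (fun t => f (x ord0 :: t))) -sumrN; apply: eq_bigr => i _.
rewrite /bump /= add1n exprS mulN1r mulNr; congr (- (_ * f _)).
rewrite enum_ordSl /= -map_comp; congr (x _ :: _); first exact: val_inj.
apply: eq_map => j /=; congr x; apply: val_inj => /=.
by rewrite /bump !add1n ltnS addnS.
Qed.

Theorem theorem3p5 (G : Grp) : pseudo_mitotic G -> boundedly_acyclic G.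
Proof.
move=> pmG m f [M0 fM0] fI fd.
(* Extension by 0 to the other lengths, so that invariance holds for lists of any length. *)
pose f' (s : seq G) := if size s == m.+2 then f (fun i => nth gone s i) else 0.
have sz n (x : 'I_n -> G) : size (map x (enum 'I_n)) = n.
  by rewrite size_map size_enum_ord.
have f'E (x : 'I_m.+2 -> G) : f' (map x (enum 'I_m.+2)) = f x.
  rewrite /f' sz eqxx; congr f; apply: funext => i.
  by rewrite (nth_map i) ?size_enum_ord // nth_ord_enum.
have tupleE n (s : seq G) : size s = n ->
    s = map (fun i : 'I_n => nth gone s i) (enum 'I_n).
  move=> ss; apply: (@eq_from_nth _ gone); first by rewrite sz.
  move=> i; rewrite ss => i_n; rewrite (nth_map (Ordinal i_n)) ?size_enum_ord //.
  by rewrite nth_enum_ord.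
have M0_ge0 : 0 <= M0.
  by apply/RleP; apply: Rle_trans (Rabs_pos _) (fM0 (fun=> gone)).
have [|||M' [h [hM hI hd]]] := @pseudo_mitotic_primitive R G m M0 f' pmG M0_ge0.
- by move=> s /tupleE ->; rewrite f'E -RabsE; apply/RleP; apply: fM0.
- move=> g s; case: (eqVneq (size s) m.+2) => [/tupleE ->|ss].
    by rewrite -map_comp !f'E fI.
  by rewrite /f' size_map (negbTE ss).
- move=> s /tupleE ->; rewrite d_coboundary -[RHS](fd (fun i => nth gone s i)).
  by apply: eq_bigr => i _; rewrite f'E.
exists (fun x => h (map x (enum 'I_m.+1))); split; [|split].
- exists M' => x; apply/RleP; rewrite RabsE; apply: hM.
  exact: sz.
- by move=> g x; rewrite -[RHS](hI g) ?sz // -map_comp.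
- move=> x; rewrite -[RHS]f'E -hd ?sz //.
  by rewrite d_coboundary.
Qed.
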